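(* There are no normalized lonely trees with an even number of vertices, and for every integer $k\ge 0$ there are precisely $A_{k+1}$ normalized lonely trees on $2k+1$ vertices, where $(A_m)_{m\ge1}$ is Lassalle's sequence.
   Context: Lassalle's sequence $(A_m)_{m\geq 1}$ is defined by $A_1=1$ and $A_m=(-1)^{m-1}C_m+\sum_{j=1}^{m-1}(-1)^{j-1}\binom{2m-1}{2m-2j-1}A_{m-j}C_j$, where $C_n=\frac{1}{n+1}\binom{2n}{n}$. A decreasing binary plane tree is a (nonempty) rooted plane tree whose vertices are labeled with distinct positive integers, in which every non-root vertex has a smaller label than its parent and every vertex has at most two children; if a vertex has exactly one child, one distinguishes whether it is a left or a right child. Such a tree is normalized if its set of labels is $\{1,\ldots,n\}$ for some $n$. The postorder $P(T)$ of a decreasing binary plane tree $T$ is the word of labels obtained by reading first the left subtree of the root, then the right subtree of the root, each recursively in postorder, and finally the root. A decreasing binary plane tree $T$ is lonely if no other decreasing binary plane tree has the same postorder as $T$. *)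

(* Defs.v *)
From HB Require Import structures.
From mathcomp Require Import all_boot all_order all_algebra.
Set Implicit Arguments.
Unset Strict Implicit.
Unset Printing Implicit Defensive.
Import GRing.Theory.
Local Open Scope ring_scope.

Definition catalan (n : nat) : nat := ('C(2 * n, n) %/ n.+1)%N.

Definition lassalle_step (A : nat -> int) (m : nat) : int :=
  (-1) ^+ (m - 1) * (catalan m)%:Z
  + \sum_(1 <= j < m)
      (-1) ^+ (j - 1) * 'C(2 * m - 1, 2 * m - 2 * j - 1)%:Z
        * A (m - j)%N * (catalan j)%:Z.

(* [n] is recursion fuel: the value at [m] is the right one once [m <= n]. *)
Fixpoint lassalle_fuel (n m : nat) : int :=
  if n is n'.+1 then lassalle_step (lassalle_fuel n') m else 0.

(* The sequence is indexed from 1; [lassalle 0 = 0] is a dummy value. *)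
Definition lassalle (m : nat) : int := lassalle_fuel m m.

Lemma lassalle_fuelE n m : (0 < m <= n)%N -> lassalle_fuel n m = lassalle m.
Proof.
rewrite /lassalle; elim/ltn_ind: m n => m IH [|n]; first by case: m {IH}.
case: m IH => [//|m] IH /andP[_ le_mn] /=; congr (_ + _).
apply: eq_big_nat => j /andP[j_gt0 lt_jm]; congr (_ * _ * _).
have lt_d : (m.+1 - j < m.+1)%N by rewrite ltn_subrL j_gt0.
have d_gt0 : (0 < m.+1 - j)%N by rewrite subn_gt0.
have le_dm : (m.+1 - j <= m)%N by [].
by rewrite (IH _ lt_d n) ?(IH _ lt_d m) // d_gt0 ?(leq_trans le_dm).
Qed.

Lemma lassalle1 : lassalle 1 = 1.
Proof. by rewrite /lassalle /= /lassalle_step big_geq // addr0. Qed.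

Lemma lassalle_rec m : (0 < m)%N ->
  lassalle m =
    (-1) ^+ (m - 1) * (catalan m)%:Z
    + \sum_(1 <= j < m)
        (-1) ^+ (j - 1) * 'C(2 * m - 1, 2 * m - 2 * j - 1)%:Z
          * lassalle (m - j) * (catalan j)%:Z.
Proof.
case: m => // m _; rewrite {1}/lassalle /=; congr (_ + _).
apply: eq_big_nat => j /andP[j_gt0 lt_jm]; congr (_ * _ * _).
by apply: lassalle_fuelE; rewrite subn_gt0 lt_jm leq_subLR -add1n leq_add2r.
Qed.

(* Possibly empty binary plane trees; an only child is left or right according
   to which of the two subtrees is [Empty]. *)
Inductive btree : Type :=
  | Empty
  | Node (l : btree) (x : nat) (r : btree).

Definition btree_eq_dec (s t : btree) : {s = t} + {s <> t}.
Proof. by decide equality; apply: eq_comparable. Defined.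

HB.instance Definition _ := hasDecEq.Build btree (compareP btree_eq_dec).

Fixpoint nvertices (t : btree) : nat :=
  if t is Node l _ r then (nvertices l + nvertices r).+1 else 0%N.

Fixpoint postorder (t : btree) : seq nat :=
  if t is Node l x r then postorder l ++ postorder r ++ [:: x] else [::].

Definition root_lt (x : nat) (t : btree) : bool :=
  if t is Node _ y _ then (y < x)%N else true.

Fixpoint decreasing (t : btree) : bool :=
  if t is Node l x r then
    [&& root_lt x l, root_lt x r, decreasing l & decreasing r]
  else true.

(* [postorder t] also serves as the list of labels of [t], one entry for each
   vertex. *)
Definition dec_bin_plane_tree (t : btree) : bool :=
  [&& t != Empty, decreasing t, uniq (postorder t)
    & all (fun x => 0 < x)%N (postorder t)].

Definition normalized (t : btree) : Prop :=
  exists n : nat, postorder t =i [pred i | 1 <= i <= n]%N.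

Definition lonely (t : btree) : Prop :=
  dec_bin_plane_tree t /\
  forall t' : btree,
    dec_bin_plane_tree t' -> postorder t' = postorder t -> t' = t.

(* Main.v *)
Require Import Defs.
From mathcomp Require Import all_boot all_order all_algebra.
From mathcomp Require Import zify ring.

(** A tree is lonely iff every vertex has zero or two children and, at every
    inner vertex, the label of the left child exceeds the first label (in
    postorder) of the right subtree: equivalently, iff the postorder has the
    maximal possible number [(n - 1) / 2] of descents.  When the condition fails
    at [x] with subtrees [l] and [r], moving [l] below the first leaf of [r]
    keeps the postorder; when it holds, the leaves are the first letter and the
    descent bottoms, so the word determines the tree.

    To count, let [B U s] be the number of lonely trees with label set [U] and
    first label [s], and let [J] be the sequence [1, 0, -C_1, 0, C_2, 0, ...].
    The condition at the root fails iff all labels of [l] lie below the first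
    label of [r], so removing the root [m = max U] gives
      [B U s = \sum_(L + R = U - m) B L s * (\sum_(f in R) B R f
                                    - \sum_(f in R, L < f) B R f)].
    Since [\sum_(p + q = n) J p * J q = - J (n + 2)], induction on [U] yields
      [\sum_(V \subset U) B V s * J #|U - V| = J #|U_{<s}| * J #|U_{>s}|],
    and summing over [s] gives Lassalle's recurrence. *)

Set Implicit Arguments.
Unset Strict Implicit.
Unset Printing Implicit Defensive.
Import GRing.Theory.

(** * Lonely trees *)

Definition first_label (t : btree) : nat := head 0 (postorder t).

Definition root_label (t : btree) : nat := last 0 (postorder t).

(** Sending [Empty] to [false] makes every vertex with exactly one child fail the last clause. *)
Fixpoint desc_full (t : btree) : bool :=
  match t with
  | Empty => false
  | Node Empty _ Empty => true
  | Node l _ r => [&& desc_full l, desc_full r & first_label r < root_label l]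
  end.

Lemma root_label_Node l x r : root_label (Node l x r) = x.
Proof. by rewrite /root_label /= !last_cat. Qed.

Lemma size_postorder t : size (postorder t) = nvertices t.
Proof.
by elim: t => //= l IHl x r IHr; rewrite !size_cat /= IHl IHr addn1 addnS.
Qed.

Lemma postorder_eq_nil t : (postorder t == [::]) = (t == Empty).
Proof. by rewrite -size_eq0 size_postorder; case: t. Qed.

Lemma first_label_Node l x r : l != Empty ->
  first_label (Node l x r) = first_label l.
Proof. by rewrite -postorder_eq_nil /first_label /=; case: (postorder l). Qed.

Lemma root_ltE x t : root_lt x t = (t == Empty) || (root_label t < x).
Proof. by case: t => // l y r; rewrite root_label_Node. Qed.

Lemma desc_full_Node l x r : l != Empty -> r != Empty ->
  desc_full (Node l x r) =
    [&& desc_full l, desc_full r & first_label r < root_label l].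
Proof. by case: l r => [|? ? ?] [|? ? ?]. Qed.

Lemma desc_full_ind (P : btree -> Prop) :
  (forall x, P (Node Empty x Empty)) ->
  (forall l x r, l != Empty -> r != Empty -> desc_full l -> desc_full r ->
     first_label r < root_label l -> P l -> P r -> P (Node l x r)) ->
  forall t, desc_full t -> P t.
Proof.
move=> P1 P2; elim=> // l IHl x r IHr.
have [->|l0] := eqVneq l Empty; have [->|r0] := eqVneq r Empty => //.
- by case: r {IHr} r0 => //= ? ? ?; rewrite andbF.
- by case: l {IHl} l0 => //= ? ? ?; rewrite andbF.
rewrite desc_full_Node // => /and3P[dl dr lt].
by apply: P2 => //; [exact: IHl|exact: IHr].
Qed.

Lemma desc_full_nonempty t : desc_full t -> t != Empty.
Proof. by case: t. Qed.

Lemma desc_full_odd t : desc_full t -> odd (nvertices t).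
Proof.
elim/desc_full_ind => // l x r _ _ _ _ _ /= ol or.
by rewrite oddD ol or.
Qed.

(** * Descents of the postorder *)

Fixpoint descents (w : seq nat) : nat :=
  if w is x :: w' then (head x w' < x) + descents w' else 0.

(** The defaults settle the empty cases: there is no junction descent if [v] is empty, nor if [u]
    is, since nothing is below 0. *)
Lemma descents_cat u v :
  descents (u ++ v) =
    descents u + (head (last 0 u) v < last 0 u) + descents v.
Proof.
elim: u => [|x [|y u] IH] /=; first by [].

  by rewrite ltnn.
by move: IH => /= ->; rewrite !addnA.
Qed.

(** A root exceeds the letter before it, so a new descent can arise only where a left subtree meets
    a right one. An only child adds a vertex and no descent; two children keep the bound tight
    exactly when both subtrees are tight and their junction is a descent. *)
Lemma descents_postorder t : decreasing t -> t != Empty ->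
  (descents (postorder t)).*2.+1 <= nvertices t ?= iff desc_full t.
Proof.
have rootP t1 : t1 != Empty -> forall x y, root_lt x t1 ->
    (head (last y (postorder t1)) [:: x] < last y (postorder t1)) = false.
  move=> n0 x y; rewrite root_ltE (negPf n0) /root_label /=.
  move: n0; rewrite -postorder_eq_nil; case: (postorder t1) => //= a s _.
  by move/ltnW; rewrite ltnNge => ->.
elim: t => // l IHl x r IHr /= /and4P[lx rx dl dr] _.
have [->|l0] := eqVneq l Empty; have [->|r0] := eqVneq r Empty => /=.
- by rewrite ltnn; apply/leqifP.
- rewrite cats1 -cats1 descents_cat /= ltnn !addn0.
  have /= -> := rootP _ r0 x 0 rx.
  have [le1 _] := IHr dr r0; rewrite !addn0 add0n.
  apply/leqifP; case: r r0 {IHr rx dr} le1 => // ? ? ? _; rewrite andbF /= ; lia.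
- rewrite descents_cat /= ltnn !addn0.
  have /= -> := rootP _ l0 x 0 lx.
  have [le1 _] := IHl dl l0; rewrite !addn0.
  apply/leqifP; case: l l0 {IHl lx dl} le1 => // ? ? ? _; rewrite andbF /= ; lia.
rewrite catA !descents_cat /= ltnn !addn0.
rewrite last_cat; have /= -> := rootP _ r0 x (last 0 (postorder l)) rx.
have := IHl dl l0; have := IHr dr r0; rewrite /leqif => -[r1 r2] [l1 l2].
rewrite -[match l with | Empty => _ | _ => _ end]/(desc_full (Node l x r)).
rewrite desc_full_Node // -l2 -r2 /first_label /root_label.
have -> : head (last 0 (postorder l)) (postorder r) = head 0 (postorder r).
  by move: r0; rewrite -postorder_eq_nil; case: (postorder r).
by case: (_ < last 0 (postorder l)); rewrite /= ?andbT ?andbF; split; lia.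
Qed.

(* Shift-reduce reading of a postorder; the state is the previous letter and the
   stack of completed subtrees. *)
Definition parse_step (s : nat * seq btree) (x : nat) : nat * seq btree :=
  (x, if x < s.1 then Node Empty x Empty :: s.2
      else if s.2 is r :: l :: st then Node l x r :: st else s.2).

(** Each leaf is below the letter read before it and each inner vertex is above, so a descent means
    shift and anything else means reduce. The hypothesis on [p] covers the first leaf. *)
Lemma foldl_parse_step t : desc_full t -> decreasing t ->
  forall p st, first_label t < p ->
  foldl parse_step (p, st) (postorder t) = (root_label t, t :: st).
Proof.
elim/desc_full_ind => [x _ p st|l x r l0 r0 fl fr lt IHl IHr dt p st].
  by rewrite /first_label /parse_step /= => ->.
rewrite first_label_Node // root_label_Node => ltp.
move: dt => /= /and4P[lx rx dl dr].
rewrite !foldl_cat IHl // IHr //= /parse_step /=.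
move: rx; rewrite root_ltE (negPf r0) /= => /ltnW.
by rewrite ltnNge => ->.
Qed.

Lemma desc_full_inj t t' : desc_full t -> desc_full t' ->
  decreasing t -> decreasing t' -> postorder t = postorder t' -> t = t'.
Proof.
move=> ft ft' dt dt' e.
(* The initial letter [(first_label t).+1] makes the first letter a descent and depends on the word
   only. *)
have := foldl_parse_step ft dt [::] (ltnSn (first_label t)).
have -> : first_label t = first_label t' by rewrite /first_label e.
by rewrite e (foldl_parse_step ft' dt') // => -[].
Qed.

(** * Other trees with the same postorder *)

Fixpoint graft (s t : btree) : btree :=
  match t with
  | Empty => s
  | Node Empty x Empty => Node s x Empty
  | Node Empty x r => Node Empty x (graft s r)
  | Node l x r => Node (graft s l) x r
  end.

Lemma graft_Nodel s l x r : l != Empty ->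
  graft s (Node l x r) = Node (graft s l) x r.
Proof. by case: l. Qed.

Lemma graft_Noder s x r : r != Empty ->
  graft s (Node Empty x r) = Node Empty x (graft s r).
Proof. by case: r. Qed.

(** The leaf that receives [s] is the first vertex of [t] in postorder. *)
Lemma postorder_graft s t : postorder (graft s t) = postorder s ++ postorder t.
Proof.
elim: t => [|l IHl x r IHr]; first by rewrite cats0.
have [->|l0] := eqVneq l Empty; last by rewrite graft_Nodel //= IHl !catA.
have [->|r0] := eqVneq r Empty; first by [].
by rewrite graft_Noder //= IHr !catA.
Qed.

Lemma root_label_graft s t : t != Empty -> root_label (graft s t) = root_label t.
Proof.
rewrite -postorder_eq_nil /root_label postorder_graft last_cat.
by case: (postorder t).
Qed.

(** The only new edge joins the root of [s] to the first leaf of [t]; the enlarged subtrees keep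
    their root labels. *)
Lemma decreasing_graft s t : t != Empty -> decreasing s -> decreasing t ->
  root_label s < first_label t -> decreasing (graft s t).
Proof.
move=> + ds; elim: t => // l IHl x r IHr _ /and4P[].
rewrite -/root_lt -/decreasing => lx rx dl dr.
have [l0|l0] := eqVneq l Empty; last first.
  rewrite first_label_Node // => lt.
  rewrite graft_Nodel //= IHl // dr rx root_ltE root_label_graft //.
  by move: lx; rewrite root_ltE (negPf l0) /= => ->; rewrite orbT.
rewrite l0; have [->|r0] := eqVneq r Empty.
  by rewrite /first_label /= ds root_ltE => ->; rewrite orbT.
have -> : first_label (Node Empty x r) = first_label r.
  rewrite /first_label /=; move: r0; rewrite -postorder_eq_nil.
  by case: (postorder r).
move=> lt; rewrite graft_Noder //= IHr // root_ltE root_label_graft //.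
by move: rx; rewrite root_ltE (negPf r0) /= => ->; rewrite orbT.
Qed.

Lemma exists_other_tree t : t != Empty -> decreasing t -> uniq (postorder t) ->
  ~~ desc_full t ->
  exists t', [/\ t' != t, decreasing t' & postorder t' = postorder t].
Proof.
elim: t => // l IHl x r IHr _ /= /and4P[lx rx dl dr].
rewrite catA !cat_uniq => /and3P[/and3P[ul /hasPn disj ur] _ _].
have [l0|l0] := eqVneq l Empty; have [r0|r0] := eqVneq r Empty.
- by rewrite l0 r0.
(* An only child can change sides. *)
- move=> _; exists (Node r x Empty); split=> //=; last by rewrite l0.
    by apply/eqP => -[_ e]; case/eqP: r0.
  by rewrite rx dr.
- move=> _; exists (Node Empty x l); split=> //=; last by rewrite r0 cats0.
    by apply/eqP => -[e _]; case/eqP: l0.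
  by rewrite lx dl.
rewrite -[X in ~~ X]/(desc_full (Node l x r)) desc_full_Node //.
have root_lt_eq u u' : postorder u' = postorder u -> root_lt x u -> root_lt x u'.
  by move=> e; rewrite !root_ltE -!postorder_eq_nil /root_label e.
case fl: (desc_full l); last first.
  have [l' [nl' dl' el']] := IHl l0 dl ul (negbT fl).
  move=> _; exists (Node l' x r); split=> /=.
  - by apply: contra nl' => /eqP[->].
  - by rewrite dl' dr rx (root_lt_eq l).
  - by rewrite el' catA.
case fr: (desc_full r); last first.
  have [r' [nr' dr' er']] := IHr r0 dr ur (negbT fr).
  move=> _; exists (Node l x r'); split=> /=.
  - by apply: contra nr' => /eqP[->].
  - by rewrite dr' dl lx (root_lt_eq r).
  - by rewrite er' catA.
(* Both subtrees pass, so the condition fails at [x] itself, and [l] moves below the first leaf of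
   [r]. *)
rewrite /= -leqNgt => le.
exists (Node Empty x (graft l r)); split=> /=; last by rewrite postorder_graft.
  by apply/eqP => -[e _]; case/eqP: l0.
rewrite root_ltE root_label_graft // decreasing_graft //.
  by move: rx; rewrite root_ltE (negPf r0) /= => ->; rewrite orbT.
(* Equality is impossible because the two labels lie in the disjoint words of [l] and [r]. *)
rewrite ltn_neqAle le andbT; apply/eqP => e.
have fr_in : first_label r \in postorder r.
  by move: r0; rewrite -postorder_eq_nil /first_label; case: (postorder r) => // a s;
  rewrite mem_head.
have := disj _ fr_in; rewrite -e /root_label => /negP; apply.
move: l0; rewrite -postorder_eq_nil; by case: (postorder l) => // a s _; exact: mem_last.
Qed.

(** For the converse, a tree with the same word has as many descents and as many vertices, so it
    attains the same equality case and is [desc_full] too. *)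
Lemma lonelyE t : lonely t <-> dec_bin_plane_tree t && desc_full t.
Proof.
rewrite /lonely; split=> [[dt h]|/andP[dt ft]].
  rewrite dt /=; apply/negPn/negP => nf.
  have /and4P[t0 d u p] := dt.
  have [t' [/eqP nt' d' e']] := exists_other_tree t0 d u nf.
  apply: nt'; apply: h => //.
  by rewrite /dec_bin_plane_tree d' -postorder_eq_nil e' postorder_eq_nil t0 u p.
split=> // t' dt' e; have /and4P[t0 d u p] := dt; have /and4P[t0' d' u' p'] := dt'.
apply: desc_full_inj => //.
rewrite -(descents_postorder d' t0') -size_postorder e size_postorder.
by rewrite (descents_postorder d t0).
Qed.

(** * Trees with a given label set *)

Lemma desc_full_EmptyE l x r :
  desc_full (Node l x r) -> (l == Empty) = (r == Empty).
Proof. by case: l r => [|? ? ?] [|? ? ?] //=; rewrite andbF. Qed.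

Lemma decreasing_le_root t y :
  decreasing t -> y \in postorder t -> y <= root_label t.
Proof.
elim: t => // l IHl x r IHr /= /and4P[lx rx dl dr].
rewrite root_label_Node !mem_cat inE => /or3P[yl|yr|/eqP-> //].
  have l0 : l != Empty by apply/eqP => e; rewrite e in yl.
  move: lx; rewrite root_ltE (negPf l0) /= => /ltnW; exact/leq_trans/IHl.
have r0 : r != Empty by apply/eqP => e; rewrite e in yr.
move: rx; rewrite root_ltE (negPf r0) /= => /ltnW; exact/leq_trans/IHr.
Qed.

Lemma root_label_mem t : t != Empty -> root_label t \in postorder t.
Proof.
rewrite -postorder_eq_nil /root_label.
by case: (postorder t) => // a s _; exact: mem_last.
Qed.

Lemma first_label_mem t : t != Empty -> first_label t \in postorder t.
Proof.
rewrite -postorder_eq_nil /first_label.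
by case: (postorder t) => // a s _; exact: mem_head.
Qed.

Fixpoint bounded_trees (N n : nat) : seq btree :=
  if n is n'.+1 then
    Empty :: [seq Node lx.1 lx.2 r |
                lx <- [seq (l, x) | l <- bounded_trees N n', x <- iota 0 N],
                r <- bounded_trees N n']
  else [:: Empty].

Lemma mem_bounded_trees N n t : nvertices t <= n ->
  all (fun x => x < N) (postorder t) -> t \in bounded_trees N n.
Proof.
elim: n t => [|n IH] [|l x r] //= le.
rewrite !all_cat /= andbT inE => /and3P[al ar xN].
apply/orP; right; apply/allpairsPdep; exists (l, x), r; split=> //=.
  by apply/allpairsPdep; exists l, x; rewrite mem_iota IH //; lia.
by apply: IH => //; lia.
Qed.

Definition labels_in (N : nat) (U : {set 'I_N}) (t : btree) : bool :=
  perm_eq (postorder t) [seq val i | i <- enum U].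

(** Positivity of the labels is left to the choice of [U], which may contain 0. *)
Definition lonely_trees (N : nat) (U : {set 'I_N}) : seq btree :=
  [seq t <- undup (bounded_trees N #|U|)
     | [&& desc_full t, decreasing t & labels_in U t]].

Lemma lonely_trees_uniq N (U : {set 'I_N}) : uniq (lonely_trees U).
Proof. by rewrite filter_uniq ?undup_uniq. Qed.

Lemma mem_lonely_trees N (U : {set 'I_N}) t :
  (t \in lonely_trees U) = [&& desc_full t, decreasing t & labels_in U t].
Proof.
rewrite mem_filter mem_undup; case: and3P => [[ft dt pt]|_] //=.
apply: mem_bounded_trees.
  by rewrite -size_postorder (perm_size pt) size_map -cardE.
by rewrite (perm_all _ pt); apply/allP => _ /mapP[i _ ->]; apply: ltn_ord.
Qed.

Lemma labels_inP N (U : {set 'I_N}) t :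
  reflect [/\ uniq (postorder t), forall y, y \in postorder t -> y < N
            & forall i : 'I_N, (val i \in postorder t) = (i \in U)]
          (labels_in U t).
Proof.
apply: (iffP idP) => [pt|[ut ltN mt]].
  split=> [|y|i].
  - by rewrite (perm_uniq pt) (map_inj_uniq val_inj) enum_uniq.
  - by rewrite (perm_mem pt) => /mapP[i _ ->]; apply: ltn_ord.
  - by rewrite (perm_mem pt) (mem_map val_inj) mem_enum.
apply: uniq_perm => //; first by rewrite (map_inj_uniq val_inj) enum_uniq.
move=> y; apply/idP/mapP => [yt|[i]].
  exists (Ordinal (ltN y yt)) => //; by rewrite mem_enum -mt.
by rewrite mem_enum -mt => it ->.
Qed.

Lemma labels_in_inj N (U V : {set 'I_N}) t :
  labels_in U t -> labels_in V t -> U = V.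
Proof. by move=> /labels_inP[_ _ mU] /labels_inP[_ _ mV]; apply/setP => i; rewrite -mU mV. Qed.

Lemma lonely_trees_nonempty N (U : {set 'I_N}) t : t \in lonely_trees U -> t != Empty.
Proof. by rewrite mem_lonely_trees => /and3P[/desc_full_nonempty]. Qed.

(** The maximum must sit at the root, and the label set [L] of the left subtree leaves the remaining
    labels to the right one. *)
Lemma Node_lonely_trees N (U : {set 'I_N}) (m : 'I_N) t : m \in U ->
  (forall i, i \in U -> i <= m) ->
  reflect
    ((t = Node Empty m Empty /\ U = [set m]) \/
     exists (L : {set 'I_N}) (l r : btree), [/\ L \subset U :\ m, l \in lonely_trees L,
       r \in lonely_trees (U :\ m :\: L), first_label r < root_label l
       & t = Node l m r])
    (t \in lonely_trees U).
Proof.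
move=> mU mmax; rewrite mem_lonely_trees; apply: (iffP and3P); last first.
  case=> [[-> ->]|[L [l [r [LU]]]]].
    by rewrite /labels_in enum_set1 /=; split.
  rewrite !mem_lonely_trees => /and3P[fl dl /labels_inP[ul ltl ml]].
  move=> /and3P[fr dr /labels_inP[ur ltr mr]] lt ->.
  have l0 := desc_full_nonempty fl; have r0 := desc_full_nonempty fr.
  have LP i : i \in L -> i \in U /\ i != m.
    by move=> /(subsetP LU); rewrite !inE => /andP[].
  have ltm i : i \in U -> i != m -> i < m.
    by move=> iU im; rewrite ltn_neqAle mmax // andbT.
  have lm y : y \in postorder l -> y < m.
    move=> yl; pose i := Ordinal (ltl y yl).
    have /LP[iU im] : i \in L by rewrite -ml.
    exact: (ltm i).
  have rm y : y \in postorder r -> y < m.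
    move=> yr; pose i := Ordinal (ltr y yr).
    have : i \in U :\ m :\: L by rewrite -mr.
    by rewrite !inE => /and3P[_ im iU]; exact: (ltm i).
  split.
  - by rewrite desc_full_Node // fl fr.
  - rewrite /= dl dr !root_ltE (negPf l0) (negPf r0) /= !andbT.
    by rewrite lm ?rm ?root_label_mem.
  apply/labels_inP; split=> /=.
  - rewrite catA !cat_uniq ul ur /= !andbT orbF; apply/andP; split.
      apply/hasPn => y yr; apply/negP => /= yl.
      pose i := Ordinal (ltr y yr).
      have : i \in U :\ m :\: L by rewrite -mr.
      by rewrite inE -ml yl.
    by apply/negP; rewrite mem_cat => /orP[/lm|/rm]; rewrite ltnn.
  - by move=> y; rewrite !mem_cat inE => /or3P[/ltl|/ltr|/eqP-> //].
  - move=> i; rewrite !mem_cat inE ml mr !inE -[val i == m]/(i == m).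
    have [->|im] := eqVneq i m; first by rewrite !orbT mU.
    case iL : (i \in L) => /=; last by rewrite orbF.
    by have [] := LP i iL.
move=> [ft dt lt]; have /labels_inP[ut ltN mt] := lt.
have t0 := desc_full_nonempty ft.
case: t ft dt lt ut ltN mt t0 => // l x r ft dt lt ut ltN mt t0.
have xt : x \in postorder (Node l x r) by rewrite !mem_cat mem_head !orbT.
have xm : x = m.
  apply/eqP; rewrite eqn_leq.
  have -> : x <= m by apply: (mmax (Ordinal (ltN x xt))); rewrite -mt.
  by have := decreasing_le_root dt; rewrite root_label_Node; apply; rewrite mt.
rewrite xm in ft dt lt ut ltN mt t0 xt *.
have [l0|l0] := eqVneq l Empty; have [r0|r0] := eqVneq r Empty.
- left; split; first by rewrite l0 r0.
  by apply/setP => i; rewrite -mt l0 r0 /= !inE.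
- by move: r0; rewrite -(desc_full_EmptyE ft) l0 eqxx.
- by move: l0; rewrite (desc_full_EmptyE ft) r0 eqxx.
right; move: ft; rewrite desc_full_Node // => /and3P[fl fr fr_lt].
move: dt => /= /and4P[lm rm dl dr].
move: ut; rewrite /= catA !cat_uniq => /and3P[/and3P[ul /hasPn disj ur] /= mlr _].
move: mlr; rewrite orbF mem_cat negb_or => /andP[ml mr].
have labl : labels_in [set i : 'I_N | val i \in postorder l] l.
  apply/labels_inP; split=> // [y yl|i]; last by rewrite inE.
  by apply: ltN; rewrite /= mem_cat yl.
exists [set i : 'I_N | val i \in postorder l], l, r; split=> //.
- apply/subsetP => i; rewrite !inE => il; rewrite -mt /= mem_cat il andbT.
  by apply: contra ml => /eqP <-.
- by rewrite mem_lonely_trees fl dl.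
- rewrite mem_lonely_trees fr dr /=; apply/labels_inP; split=> // [y yr|i].
    by apply: ltN; rewrite /= !mem_cat yr orbT.
  rewrite !inE -mt /= !mem_cat inE -[val i == m]/(i == m).
  case: (boolP (val i \in postorder r)) => [ir|ir].
    rewrite (disj _ ir) orbT andbT /=.
    by apply/esym; apply: contra mr => /eqP <-.
  by rewrite /=; case: (_ \in postorder l) => //=; case: eqP.
Qed.

(** * Catalan and Lassalle numbers *)

Lemma catalan_bin n : n.+1 * catalan n = 'C(2 * n, n).
Proof.
rewrite /catalan mulnC divnK //.
(* The quotient comes from [(n+1) C(2n, n+1) = n C(2n, n)]. *)
apply/dvdnP; exists ('C(2 * n, n) - 'C(2 * n, n.+1)).
have e : n.+1 * 'C(2 * n, n.+1) = n * 'C(2 * n, n).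
  by rewrite mul_bin_left; congr (_ * _); lia.
by rewrite [RHS]mulnC mulnBr e mulSn addnK.
Qed.

Lemma catalanS n : n.+2 * catalan n.+1 = (4 * n + 2) * catalan n.
Proof.
apply/eqP; rewrite -(eqn_pmul2l (ltn0Sn n)); apply/eqP.
rewrite catalan_bin mulnCA catalan_bin.
have -> : 2 * n.+1 = (2 * n).+2 by lia.
rewrite -(mul_bin_diag (2 * n).+2 n) /=.
have -> : (2 * n).+2 = 2 * ((2 * n).+1 - n) by lia.
by rewrite -mulnA -mul_bin_down /= mulnA; congr (_ * _); lia.
Qed.

Local Open Scope ring_scope.

(** By symmetry the index-weighted sum satisfies [2 T k = k S k], and the recurrence for [c]
    expresses [T (n+1) + S (n+1)] through [T n] and [S n]. Eliminating [T] leaves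
    [(n+3) S (n+1) = (4n+6) c (n+1)], the recurrence of [c] itself. *)
Lemma catalan_conv n :
  \sum_(i < n.+1) (catalan i)%:Z * (catalan (n - i))%:Z = (catalan n.+1)%:Z.
Proof.
pose c i : int := (catalan i)%:Z.
have cS i : (i%:Z + 2) * c i.+1 = (i%:Z * 4 + 2) * c i.
  by have := catalanS i; rewrite /c; lia.
pose S k := \sum_(i < k.+1) c i * c (k - i)%N.
pose T k := \sum_(i < k.+1) i%:Z * (c i * c (k - i)%N).
have TS k : T k *+ 2 = k%:Z * S k.
  have Trev : T k = \sum_(i < k.+1) (k - i)%N%:Z * (c i * c (k - i)%N).
    rewrite /T (reindex_inj rev_ord_inj) /=; apply: eq_bigr => i _.
    by rewrite subSS subKn -1?ltnS // [c (k - i)%N * _]mulrC.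
  rewrite mulr2n {1}Trev /T /S mulr_sumr -big_split /=; apply: eq_bigr => i _.
  by rewrite -mulrDl -PoszD subnK // -ltnS.
rewrite -/c -[LHS]/(S n); elim: n => [|n IH].
  by rewrite /S big_ord1 /c /catalan.
have e : T n.+1 + S n.+1 = c n.+1 + ((T n *+ 4) + (S n *+ 2)).
  rewrite /T /S -big_split big_ord_recl /= subn0.
  rewrite mul0r add0r {1}/c [X in X%:Z]/(catalan 0) mul1r; congr (_ + _).
  rewrite -!sumrMnl -big_split; apply: eq_bigr => i _ /=.
  rewrite /bump /= add1n subSS.
  transitivity ((i%:Z + 2) * c i.+1 * c (n - i)%N); last by rewrite cS; ring.
  by rewrite -addn1 PoszD; ring.
have := TS n.+1; have := TS n; have := cS n.+1; rewrite IH in e *.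
rewrite -/(c n.+2) => h1 h2 h3; apply: (@mulfI _ (n.+1%:Z + 2)) => //; rewrite h1.
transitivity ((T n.+1 + S n.+1) *+ 2); first by rewrite mulrnDl h3; ring.
have e4 : T n *+ 4 = T n *+ 2 *+ 2 by rewrite -mulrnA.
by rewrite e e4 h2 -addn1 PoszD; ring.
Qed.

(* The signed moments of the semicircle law; the exponential generating function
   is [J_1(2x)/x]. *)
Definition scat (n : nat) : int :=
  if odd n then 0 else (-1) ^+ n./2 * (catalan n./2)%:Z.

Lemma scat0 : scat 0 = 1. Proof. by []. Qed.

Lemma scat_odd n : odd n -> scat n = 0.
Proof. by rewrite /scat => ->. Qed.

Lemma scat_double n : scat n.*2 = (-1) ^+ n * (catalan n)%:Z.
Proof. by rewrite /scat odd_double doubleK. Qed.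

Lemma sum_ord_double (V : nmodType) (F : nat -> V) n :
  \sum_(i < n.*2) F i = \sum_(i < n) (F i.*2 + F i.*2.+1).
Proof.
elim: n => [|n IH]; first by rewrite !big_ord0.
by rewrite doubleS !big_ord_recr /= IH addrA.
Qed.

(** If [n] is odd, each product has an odd index. If [n = 2k], the even indices give the Catalan
    convolution with common sign [(-1)^k]. *)
Lemma scat_conv n : \sum_(p < n.+1) scat p * scat (n - p) = - scat n.+2.
Proof.
have [on|en] := boolP (odd n).
  rewrite [scat n.+2]scat_odd /= ?negbK // oppr0 big1 // => p _.
  have [op|ep] := boolP (odd p); first by rewrite scat_odd ?mul0r.
  have le_pn : (p <= n)%N by rewrite -ltnS.
  by rewrite [scat (n - p)]scat_odd ?mulr0 // oddB // on (negPf ep).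
have -> : n = n./2.*2 by rewrite -[LHS]odd_double_half (negPf en).
move: (n./2) => k.
(* The added index [2k+1] is odd, so its term is 0; the terms can now be paired. *)
have -> : \sum_(p < k.*2.+1) scat p * scat (k.*2 - p) =
          \sum_(p < k.+1.*2) scat p * scat (k.*2 - p).
  rewrite doubleS [RHS]big_ord_recr /= [scat k.*2.+1]scat_odd ?mul0r ?addr0 //=.
  by rewrite odd_double.
rewrite (sum_ord_double (fun p => scat p * scat (k.*2 - p))).
rewrite -doubleS scat_double -catalan_conv mulr_sumr -sumrN.
apply: eq_bigr => i _.
rewrite [scat i.*2.+1]scat_odd ?mul0r ?addr0 /= ?odd_double //.
rewrite -doubleB !scat_double exprS.
have -> : (-1) ^+ k = (-1) ^+ i * (-1) ^+ (k - i) :> int.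
  by rewrite -exprD subnKC // -ltnS.
by ring.
Qed.

Definition odd_lassalle (n : nat) : int := if odd n then lassalle n.+1./2 else 0.

(** For [n = 2m+1] only odd [i] contribute, and this is the recurrence for [lassalle m.+1] with the
    sum moved to the other side. For even [n] each product has a zero factor. *)
Lemma odd_lassalle_conv n :
  \sum_(i < n.+1) 'C(n, i)%:Z * (odd_lassalle i * scat (n - i)) = - scat n.+1.
Proof.
have [on|en] := boolP (odd n); last first.
  rewrite [scat n.+1]scat_odd // oppr0 big1 // => i _.
  rewrite /odd_lassalle; case: ifP => oi; last by rewrite mul0r mulr0.
  have le_in : (i <= n)%N by rewrite -ltnS.
  by rewrite scat_odd ?mulr0 // oddB // (negPf en) oi.
have -> : n = n./2.*2.+1 by rewrite -[LHS]odd_double_half on.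
move: (n./2) => m; rewrite -doubleS scat_double.
rewrite (sum_ord_double (fun i => 'C(m.*2.+1, i)%:Z *
  (odd_lassalle i * scat (m.*2.+1 - i)))).
(* Reversal puts the term of [lassalle m.+1] first; the others then cancel one by one against the
   sum in the recurrence. *)
rewrite (reindex_inj rev_ord_inj) /= big_ord_recl /=.
have := @lassalle_rec m.+1 isT.
rewrite big_add1 big_mkord /= subn1 /= => h.
have le0 i : odd_lassalle i.*2 = 0 by rewrite /odd_lassalle odd_double.
have le1 i : odd_lassalle i.*2.+1 = lassalle i.+1.
  by rewrite /odd_lassalle /= odd_double /= ?doubleK ?uphalf_double.
rewrite le0 le1 subnn scat0 mul0r mulr0 mulr1 add0r binn mul1r.
rewrite h -addrA -big_split big1 ?addr0.
  by rewrite exprS; ring.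
move=> i _ /=; rewrite le0 le1 mul0r mulr0 add0r /bump /= !add1n.
have lt_im := ltn_ord i.
have -> : (2 * m.+1 - 2 * i.+1 - 1 = (m.+1 - i.+2).*2.+1)%N by lia.
have -> : (2 * m.+1 - 1 = m.*2.+1)%N by lia.
have -> : (m.+1 - i.+1 = (m.+1 - i.+2).+1)%N by lia.
have -> : (m.*2.+1 - (m.+1 - i.+2).*2.+1 = i.+1.*2)%N by lia.
by rewrite scat_double subn1 /= exprS; ring.
Qed.

(** * Sums over subsets *)

Lemma sum_subset_setD1 (V : nmodType) (T : finType) (m : T) (U : {set T})
    (F : {set T} -> V) : m \in U ->
  \sum_(A : {set T} | A \subset U) F A =
  \sum_(A : {set T} | A \subset U :\ m) F A
  + \sum_(A : {set T} | A \subset U :\ m) F (m |: A).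
Proof.
move=> mU; rewrite (bigID (fun A : {set T} => m \in A)) /= addrC; congr (_ + _).
  by apply: eq_bigl => A; rewrite subsetD1.
rewrite (reindex_onto (fun A : {set T} => m |: A) (fun A => A :\ m)) /=.
  apply: eq_bigl => A; rewrite subUset sub1set mU setU11 andbT subsetD1.
  congr (_ && _); apply/eqP/idP => [<-|mA]; first by rewrite setD11.
  by rewrite setU1K.
by move=> A /andP[_ mA]; rewrite setD1K.
Qed.

(** Both sides run over the ordered partitions of [U] into three possibly empty blocks; [A] is the
    union of the first two. *)
Lemma sum_subset_split (V : nmodType) (T : finType) (U : {set T})
    (H : {set T} -> {set T} -> {set T} -> V) :
  \sum_(A : {set T} | A \subset U) \sum_(L : {set T} | L \subset A)
     H L (A :\: L) (U :\: A) =
  \sum_(L : {set T} | L \subset U) \sum_(R : {set T} | R \subset U :\: L)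
     H L R (U :\: L :\: R).
Proof.
rewrite (exchange_big_dep (fun L : {set T} => L \subset U)) /=; last first.
  by move=> A L AU LA; apply: subset_trans AU.
apply: eq_bigr => L LU.
rewrite (reindex_onto (fun R : {set T} => L :|: R) (fun A => A :\: L)) /=.
  apply: eq_big => [R|R].
    rewrite subsetUl andbT subUset LU subsetD setDUl setDv set0U /=.
    congr (_ && _); apply/eqP/idP => [<-|/setDidPl //].
    by rewrite disjoint_sym -setI_eq0 setIDA setIC setDIl setDv setI0.
  move=> /andP[_ /eqP->]; congr (H _ _ _).
  by rewrite setDDl.
by move=> A /andP[_ LA]; rewrite setUC -{2}(setIidPr LA) setUC setID.
Qed.

Lemma sum_subset_card (V : zmodType) (T : finType) (U : {set T}) (F : nat -> V) :
  \sum_(A : {set T} | A \subset U) F #|A| =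
  \sum_(i < #|U|.+1) F i *+ 'C(#|U|, i).
Proof.
rewrite (partition_big (fun A : {set T} => inord #|A| : 'I_#|U|.+1) xpredT) //=.
apply: eq_bigr => i _.
have -> : 'C(#|U|, i) = #|[set A : {set T} | A \subset U & #|A| == i]|.
  by rewrite cards_draws.
rewrite -[X in _ *+ X]sum1_card -sumrMnr.
rewrite (eq_bigl (fun A : {set T} => A \in [set B : {set T} | B \subset U & #|B| == i])).
  by apply: eq_bigr => A; rewrite inE => /andP[_ /eqP->].
move=> A; rewrite inE; apply: andb_id2l => /subset_leq_card le.
by rewrite -val_eqE /= inordK.
Qed.

(** The index [p] is the rank of [f] in [U]; the induction removes the maximum. *)
Lemma sum_ord_rank (V : nmodType) (N : nat) (U : {set 'I_N}) (G : nat -> nat -> V) :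
  \sum_(f in U) G #|[set i in U | (i < f)%N]| #|[set i in U | (f < i)%N]| =
  \sum_(p < #|U|) G p (#|U|.-1 - p)%N.
Proof.
move: {2}#|U| (erefl #|U|) => n; elim: n U G => [|n IH] U G cU.
  by rewrite cU big_ord0 (cards0_eq cU) big_set0.
have /card_gt0P [x0 x0U] : (0 < #|U|)%N by rewrite cU.
pose m := [arg max_(i > x0 in U) val i].
have [mU mmax] : m \in U /\ forall j, j \in U -> (j <= m)%N.
  by rewrite /m; case: arg_maxnP.
have cU' : #|U :\ m| = n by move: cU; rewrite (cardsD1 m U) mU => -[].
rewrite (big_setD1 m) //= cU big_ord_recr /= subnn addrC; congr (_ + _).
  transitivity (\sum_(p < n) G p (n.-1 - p).+1%N).
    (* Every other element has [m] above it, hence the shift in [G]. *)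
    have := IH _ (fun a b => G a b.+1) cU'; rewrite cU' => <-.
    apply: eq_bigr => f; rewrite !inE => /andP[fm fU].
    have ltfm : (f < m)%N by rewrite ltn_neqAle -[nat_of_ord f == _]/(f == m) fm mmax.
    congr (G _ _).
      apply: eq_card => i; rewrite !inE; case: eqP => //= ->.
      by rewrite ltnNge ltnW // andbF.
    rewrite [LHS](cardsD1 m) !inE mU ltfm add1n; congr _.+1.
    by apply: eq_card => i; rewrite !inE andbA.
  by apply: eq_bigr => p _; congr (G _ _); have := ltn_ord p; lia.
congr (G _ _).
  rewrite -cU'; apply: eq_card => i; rewrite !inE andbC.
  by case: (boolP (i \in U)) => iU; rewrite ?andbF // !andbT ltn_neqAle (mmax i iU) andbT.
apply: eq_card0 => i; rewrite !inE; apply/negbTE/negP => /andP[/mmax].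
by rewrite leqNgt => /negP.
Qed.

(** * Counting *)

Lemma sum_lonely_trees N (U : {set 'I_N}) (m : 'I_N) (F : btree -> int) :
  m \in U -> (forall i, i \in U -> (i <= m)%N) ->
  \sum_(t <- lonely_trees U) F t =
  (if U == [set m] then F (Node Empty m Empty) else 0)
  + \sum_(L : {set 'I_N} | L \subset U :\ m) \sum_(l <- lonely_trees L)
      \sum_(r <- lonely_trees (U :\ m :\: L) | (first_label r < root_label l)%N)
        F (Node l m r).
Proof.
move=> mU mmax.
pose U' := U :\ m.
pose Ls := [seq L : {set 'I_N} <- index_enum {set 'I_N} | L \subset U'].
pose Lls := [seq (L, l) | L <- Ls, l <- lonely_trees L].
pose rs (Ll : {set 'I_N} * btree) :=
  [seq r <- lonely_trees (U' :\: Ll.1) | (first_label r < root_label Ll.2)%N].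
pose nodes := [seq Node Ll.2 m r | Ll <- Lls, r <- rs Ll].
pose leaf := if U == [set m] then [:: Node Empty m Empty] else [::].
have memLls L l : ((L, l) \in Lls) = (L \subset U') && (l \in lonely_trees L).
  apply/allpairsPdep/andP => [[L1 [l1 [+ l1L [-> ->]]]]|[LU lL]].
    by rewrite mem_filter => /andP[].
  by exists L, l; rewrite mem_filter LU mem_index_enum.
have -> : \sum_(t <- lonely_trees U) F t = \sum_(t <- leaf ++ nodes) F t.
  apply: perm_big; apply: uniq_perm; first exact: lonely_trees_uniq.
    rewrite cat_uniq; apply/and3P; split.
    - by rewrite /leaf; case: ifP.
    - apply/hasPn => t /allpairsPdep[[L l] [r [+ _ ->]]].
      rewrite memLls => /andP[_ /lonely_trees_nonempty l0].
      rewrite /leaf; case: ifP => // _; rewrite inE.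
      by apply: contra l0 => /eqP[->].
    apply: allpairs_uniq_dep.
    - apply: allpairs_uniq_dep.
      + by rewrite filter_uniq // index_enum_uniq.
      + by move=> L _; apply: lonely_trees_uniq.
      + by move=> [L1 l1] [L2 l2] _ _ /= [-> ->].
    - by move=> Ll _; rewrite filter_uniq // lonely_trees_uniq.
    (* The tree determines [l], and [l] determines its label set, so no tree is listed twice. *)
    - move=> [[L1 l1] r1] [[L2 l2] r2] /=.
      move=> /allpairsPdep[[L3 l3] [r3 [+ _ [-> -> _]]]].
      move=> + /allpairsPdep[[L4 l4] [r4 [+ _ [-> -> _]]]] => + + [e1 e2].
      rewrite !memLls e1 !mem_lonely_trees.
      move=> /andP[_ /and3P[_ _ la]] /andP[_ /and3P[_ _ lb]].
      by rewrite (labels_in_inj la lb) e2.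
  move=> t; rewrite mem_cat; apply/(Node_lonely_trees _ mU mmax)/orP.
    case=> [[-> e]|[L [l [r [LU lL rR lt ->]]]]].
      by left; rewrite /leaf e eqxx mem_head.
    right; apply/allpairsPdep; exists (L, l), r; split=> //.
      by rewrite memLls LU.
    by rewrite mem_filter lt.
  case=> [|/allpairsPdep[[L l] [r [+ + ->]]]].
    by rewrite /leaf; case: eqP => // e; rewrite inE => /eqP->; left.
  rewrite memLls => /andP[LU lL]; rewrite mem_filter => /andP[lt rR].
  by right; exists L, l, r.
rewrite big_cat; congr (_ + _).
  by rewrite /leaf; case: ifP => _; rewrite ?big_seq1 ?big_nil.
rewrite /nodes big_allpairs_dep /Lls big_allpairs_dep /Ls big_filter.
by apply: eq_bigr => L _; apply: eq_bigr => l _; rewrite big_filter.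
Qed.

Definition num_lonely (N : nat) (U : {set 'I_N}) : int := (size (lonely_trees U))%:Z.

(** This is [B U s] of the counting argument. *)
Definition num_first (N : nat) (U : {set 'I_N}) (s : 'I_N) : int :=
  \sum_(t <- lonely_trees U) (first_label t == s)%:Z.

Lemma first_label_lonely N (U : {set 'I_N}) t : t \in lonely_trees U ->
  exists2 f : 'I_N, f \in U & first_label t = f.
Proof.
move=> tU; have /first_label_mem ft := lonely_trees_nonempty tU.
move: tU; rewrite mem_lonely_trees => /and3P[_ _ /labels_inP[_ ltN mt]].
by exists (Ordinal (ltN _ ft)); rewrite -?mt.
Qed.

Lemma num_first_eq0 N (U : {set 'I_N}) (s : 'I_N) : s \notin U -> num_first U s = 0.
Proof.
move=> sU; rewrite /num_first big1_seq // => t /andP[_ /first_label_lonely[f fU ->]].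
by case: eqP => // /val_inj e; rewrite -e fU in sU.
Qed.

Lemma sum_num_first N (U : {set 'I_N}) (P : pred nat) :
  \sum_(f in U | P f) num_first U f =
  \sum_(t <- lonely_trees U) (P (first_label t))%:Z.
Proof.
rewrite exchange_big /=; apply: eq_big_seq => t /first_label_lonely[f fU ->].
case Pf: (P f).
  rewrite (bigD1 f) /= ?fU ?Pf // eqxx big1 // => i /andP[_ /negPf].
  by rewrite -val_eqE eq_sym => ->.
rewrite big1 // => i /andP[_ Pi]; case: eqP => // e.
by rewrite -e Pf in Pi.
Qed.

Lemma num_lonelyE N (U : {set 'I_N}) : num_lonely U = \sum_(f in U) num_first U f.
Proof.
have := sum_num_first U xpredT; rewrite (eq_bigl (mem U)) => [->|f]; last by rewrite andbT.
by rewrite big_const_seq count_predT iter_addr addr0 /num_lonely natz.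
Qed.

(** The root of [l] is the largest label in [L], so the descent condition fails exactly when [L]
    lies below the first label of [r]. Since [s != m], the single leaf does not count. *)
Lemma num_first_rec N (U : {set 'I_N}) (m s : 'I_N) :
  m \in U -> (forall i, i \in U -> (i <= m)%N) -> s != m ->
  num_first U s =
  \sum_(L : {set 'I_N} | L \subset U :\ m) num_first L s *
    (num_lonely (U :\ m :\: L)
     - \sum_(f in U :\ m :\: L | [forall i in L, (i < f)%N])
         num_first (U :\ m :\: L) f).
Proof.
move=> mU mmax sm; rewrite {1}/num_first (sum_lonely_trees _ mU mmax).
have -> : first_label (Node Empty m Empty) = m by [].
rewrite [nat_of_ord m == s](_ : _ = false); last by rewrite eq_sym; apply: negbTE.
rewrite if_same add0r; apply: eq_bigr => L LU.
rewrite /num_first mulr_suml; apply: eq_big_seq => l lL.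
have l0 := lonely_trees_nonempty lL.
move: lL; rewrite mem_lonely_trees => /and3P[_ dl /labels_inP[_ ltN ml]].
rewrite (sum_num_first _ (fun f => [forall i in L, (i < f)%N])).
transitivity ((first_label l == s)%:Z *
   \sum_(r <- lonely_trees (U :\ m :\: L)) (first_label r < root_label l)%N%:Z).
  rewrite mulr_sumr big_mkcond; apply: eq_bigr => r _.
  by rewrite first_label_Node //; case: ifP => _; rewrite ?mulr1 ?mulr0.
congr (_ * _).
transitivity (\sum_(r <- lonely_trees (U :\ m :\: L)) (1%:Z : int)
  - \sum_(r <- lonely_trees (U :\ m :\: L)) [forall i in L, (i < first_label r)%N]%:Z).
  have negbZ (b : bool) : (~~ b)%:Z = 1%:Z - b%:Z by case: b.
  rewrite -sumrB; apply: eq_big_seq => r rR.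
  have [f + fr] := first_label_lonely rR.
  rewrite inE => /andP[fL _].
  suff -> : (first_label r < root_label l)%N = ~~ [forall i in L, (i < first_label r)%N].
    exact: negbZ.
  rewrite fr negb_forall; apply/idP/existsP => [lt|[i]].
    have rl := root_label_mem l0.
    by exists (Ordinal (ltN _ rl)); rewrite negb_imply -ml rl -leqNgt ltnW.
  rewrite negb_imply -leqNgt => /andP[iL fi]; have := decreasing_le_root dl; move/(_ i).
  rewrite ml => /(_ iL) ir.
  rewrite ltn_neqAle (leq_trans fi ir) andbT; apply: contra fL => /eqP e.
  by rewrite -ml /= e root_label_mem.
congr (_ - _).
by rewrite big_const_seq count_predT iter_addr addr0 /num_lonely natz.
Qed.

(** In a tree with more than one vertex the first label belongs to the left subtree, hence is not
    the maximum. *)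
Lemma num_first_max N (U : {set 'I_N}) (m : 'I_N) :
  m \in U -> (forall i, i \in U -> (i <= m)%N) ->
  num_first U m = (U == [set m])%:Z.
Proof.
move=> mU mmax; rewrite /num_first (sum_lonely_trees _ mU mmax).
have -> : first_label (Node Empty m Empty) = m by [].
rewrite eqxx big1 ?addr0 => [|L LU]; first by case: eqP.
rewrite big1_seq // => l /andP[_ lL]; rewrite big1 // => r _.
rewrite first_label_Node ?(lonely_trees_nonempty lL) //.
have [f fL ->] := first_label_lonely lL.
by move/(subsetP LU): fL; rewrite !inE => /andP[/negPf]; rewrite -val_eqE /= => ->.
Qed.

Lemma sum_scat_rank N (U : {set 'I_N}) :
  \sum_(f in U) scat #|[set i in U | (i < f)%N]| * scat #|[set i in U | (f < i)%N]|
  = - scat #|U|.+1.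
Proof.
rewrite (sum_ord_rank U (fun a b => scat a * scat b)).
by case: #|U| => [|n]; [rewrite big_ord0 | rewrite scat_conv].
Qed.

(** * The convolution identity *)

Definition conv_first (N : nat) (U : {set 'I_N}) (s : 'I_N) : int :=
  \sum_(V : {set 'I_N} | V \subset U) num_first V s * scat #|U :\: V|.

Definition conv_first_formula (N : nat) (U : {set 'I_N}) : Prop :=
  forall s, s \in U ->
  conv_first U s = scat #|[set i in U | (i < s)%N]| * scat #|[set i in U | (s < i)%N]|.

(** Summing the formula over [s] collects all first labels on one side and convolves [scat] with
    itself on the other. *)
Lemma sum_num_lonely N (U : {set 'I_N}) : conv_first_formula U ->
  \sum_(V : {set 'I_N} | V \subset U) num_lonely V * scat #|U :\: V| = - scat #|U|.+1.
Proof.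
move=> cU; rewrite -sum_scat_rank -(eq_bigr _ cU) /conv_first exchange_big /=.
apply: eq_bigr => V VU; rewrite num_lonelyE -mulr_suml; congr (_ * _).
rewrite [RHS](big_setID V) /= (setIidPr VU) [X in _ + X]big1 ?addr0 // => i.
by rewrite inE => /andP[iV _]; exact: num_first_eq0.
Qed.

(* Continuous form: with [J(x) = J_1(2x)/x], the density [b(t, s)] of trees with
   root at most [t] and first label [s] is [J(s) J(t - s) / J(t)]. *)
Lemma conv_firstE N (U : {set 'I_N}) : conv_first_formula U.
Proof.
move: {2}#|U|.+1 (ltnSn #|U|) => n; elim: n U => // n IH U cU s sU.
pose m := [arg max_(i > s in U) val i].
have [mU mmax] : m \in U /\ forall j, j \in U -> (j <= m)%N.
  by rewrite /m; case: arg_maxnP.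
have cU' : (#|U :\ m| < n)%N by move: cU; rewrite (cardsD1 m U) mU.
(* If [s] is the maximum, only [V = [set m]] contributes. *)
have [sm|sm] := eqVneq s m.
  rewrite sm /conv_first (bigD1 [set m]) ?sub1set //= [X in _ + X]big1 => [|V].
    rewrite num_first_max ?inE // => [|i]; last by rewrite inE => /eqP->.
    rewrite eqxx mul1r addr0.
    have -> : [set i in U | (m < i)%N] = set0.
      apply/setP => i; rewrite !inE; apply/negbTE/negP => /andP[/mmax].
      by rewrite leqNgt => /negP.
    rewrite cards0 scat0 mulr1; congr (scat _); apply: eq_card => i; rewrite !inE.
    case: (boolP (i \in U)) => iU; rewrite ?andbF // andbT /=.
    by rewrite ltn_neqAle mmax // andbT.
  move=> /andP[VU Vm]; case: (boolP (m \in V)) => mV; last by rewrite num_first_eq0 ?mul0r.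
  rewrite num_first_max ?(negPf Vm) ?mul0r // => i iV.
  by apply: mmax; apply: (subsetP VU).
have ltsm : (s < m)%N by rewrite ltn_neqAle mmax // andbT.
set U' := U :\ m in cU'.
have sU' : s \in U' by rewrite !inE sm.
(* The sets containing [m] are expanded by removing the root, then regrouped by the label set [L] of
   the left subtree. *)
rewrite /conv_first (sum_subset_setD1 _ mU) -/U'.
have -> : \sum_(V : {set 'I_N} | V \subset U')
    num_first (m |: V) s * scat #|U :\: (m |: V)| =
  \sum_(V : {set 'I_N} | V \subset U') \sum_(L : {set 'I_N} | L \subset V)
    num_first L s * (num_lonely (V :\: L)
     - \sum_(f in V :\: L | [forall i in L, (i < f)%N]) num_first (V :\: L) f)
    * scat #|U' :\: V|.
  apply: eq_bigr => V VU; rewrite -setDDl -/U'.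
  have mV : m \notin V by apply/negP => /(subsetP VU); rewrite !inE eqxx.
  rewrite (num_first_rec (m := m)) ?setU11 // ?setU1K // ?mulr_suml // => i.
  rewrite !inE => /orP[/eqP-> //|/(subsetP VU)]; rewrite !inE => /andP[_]; exact: mmax.
rewrite (sum_subset_split U' (fun L R K => num_first L s * (num_lonely R
     - \sum_(f in R | [forall i in L, (i < f)%N]) num_first R f) * scat #|K|)).
rewrite -big_split /=.
have -> : #|[set i in U | (i < s)%N]| = #|[set i in U' | (i < s)%N]|.
  apply: eq_card => i; rewrite !inE; case: eqP => //= ->.
  by rewrite [(m < s)%N]ltnNge ltnW // andbF.
pose W := [set i in U' | (s < i)%N].
have -> : #|[set i in U | (s < i)%N]| = #|W|.+1.
  rewrite (cardsD1 m) inE mU ltsm add1n; congr _.+1.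
  by apply: eq_card => i; rewrite !inE andbA.
(* The maximum accounts for the successor, so the last factor expands over the elements [f] of
   [W]. *)
rewrite -[scat #|W|.+1]opprK -sum_scat_rank.
transitivity (- \sum_(L : {set 'I_N} | L \subset U')
   \sum_(f in U' :\: L | [forall i in L, (i < f)%N])
   num_first L s * (scat #|[set i in U' :\: L | (i < f)%N]| * scat #|[set i in U' | (f < i)%N]|)).
  rewrite -sumrN; apply: eq_bigr => L LU.
  have cR : (#|U' :\: L| < n)%N.
    by apply: leq_ltn_trans cU'; apply: subset_leq_card; apply: subsetDl.
  have -> : #|U :\: L| = #|U' :\: L|.+1.
    rewrite (cardsD1 m) !inE mU andbT.
    have -> : m \notin L by apply/negP => /(subsetP LU); rewrite !inE eqxx.
    by rewrite add1n; congr _.+1; apply: eq_card => i; rewrite !inE andbCA.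
  (* The term without [m] is minus the full convolution of [num_lonely] on [U' :\: L]; it cancels
     the unrestricted part and leaves only the subtracted sum over [f]. *)
  rewrite -[scat _.+1]opprK -(sum_num_lonely (IH _ cR)) mulrN mulr_sumr -sumrN -big_split /=.
  rewrite -mulr_sumr -mulrN -sumrN.
  under eq_bigr => R _ do rewrite -mulrA -mulrN -mulrDr mulrBl addrA addNr add0r.
  rewrite -mulr_sumr; congr (_ * _); rewrite !sumrN; congr (- _).
  under eq_bigr => R RU.
    rewrite mulr_suml.
    rewrite (_ : \sum_(f in R | _) _ = \sum_(f in U' :\: L | [forall i in L, (i < f)%N])
       num_first R f * scat #|U' :\: L :\: R|); last first.
      rewrite [RHS](bigID (mem R)) /= [X in _ + X]big1 ?addr0.
        apply: eq_bigl => f; rewrite andbAC; congr (_ && _).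
        by apply/idP/andP => [fR|[]//]; rewrite fR (subsetP RU).
      by move=> f /andP[_ fR]; rewrite num_first_eq0 ?mul0r.
    over.
  rewrite exchange_big /=; apply: eq_bigr => f /andP[fR /forall_inP fL].
  rewrite -[LHS]/(conv_first _ f) (IH _ cR) //; congr (_ * scat _).
  (* All of [L] lies below [f], so deleting [L] does not change the number of labels above [f]. *)
  apply: eq_card => i; rewrite !inE; case iL: (i \in L) => //=.
  by rewrite [(f < i)%N]ltnNge ltnW ?andbF ?fL.
rewrite mulrN mulr_sumr; congr (- _).
rewrite (exchange_big_dep (mem U')) /=; last by move=> L f _ /andP[/setDP[]].
(* If [f <= s], no [L] below [f] contains [s]. *)
rewrite [LHS](bigID (fun f : 'I_N => (s < f)%N)) /= [X in _ + X]big1 ?addr0; last first.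
  move=> f /andP[_ sf]; apply: big1 => L /andP[_ /andP[_ /forall_inP fL]].
  by rewrite num_first_eq0 ?mul0r //; apply: contra sf => /fL.
rewrite [RHS](eq_bigl (fun f => (f \in U') && (s < f)%N)); last by move=> f; rewrite inE.
apply: eq_bigr => f /andP[fU sf].
(* The sets [L] that remain are the subsets of [X], so the induction hypothesis applies a second
   time, to [X] and [s]. *)
pose X := [set i in U' | (i < f)%N].
have cX : (#|X| < n)%N.
  apply: leq_ltn_trans cU'; apply: subset_leq_card; apply/subsetP => i.
  by rewrite inE => /andP[].
have sX : s \in X by rewrite inE sU'.
have := IH X cX s sX; rewrite /conv_first.
have -> : #|[set i in X | (i < s)%N]| = #|[set i in U' | (i < s)%N]|.
  apply: eq_card => i; rewrite !inE.
  by case: (ltnP i s) => lt_is; rewrite ?andbF // (ltn_trans lt_is sf) !andbT.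
have -> : #|[set i in X | (s < i)%N]| = #|[set i in W | (i < f)%N]|.
  by apply: eq_card => i; rewrite !inE andbAC.
have -> : #|[set i in W | (f < i)%N]| = #|[set i in U' | (f < i)%N]|.
  apply: eq_card => i; rewrite !inE.
  by case: (ltnP f i) => lt_fi; rewrite ?andbF // (ltn_trans sf lt_fi) !andbT.
move=> e; rewrite [RHS]mulrA -e mulr_suml.
apply: eq_big => [L|L /andP[_ /andP[fL /forall_inP Lf]]].
  apply/and3P/subsetP => [[LU _ /forall_inP Lf] i iL|LX].
    by rewrite inE (subsetP LU) ?Lf.
  split.
  - by apply/subsetP => i /LX; rewrite inE => /andP[].
  - by rewrite inE fU andbT; apply/negP => /LX; rewrite inE ltnn andbF.
  - by apply/forall_inP => i /LX; rewrite inE => /andP[].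
rewrite mulrA; congr (_ * scat _ * _).
by apply: eq_card => i; rewrite !inE -!andbA.
Qed.

(** Both sides have the same convolution with [scat] over the subsets of [U]. Since [scat 0 = 1],
    the term at [U] is determined by those at proper subsets. *)
Lemma num_lonely_card N (U : {set 'I_N}) : num_lonely U = odd_lassalle #|U|.
Proof.
move: {2}#|U|.+1 (ltnSn #|U|) => n; elim: n U => // n IH U cU.
have e1 := sum_num_lonely (@conv_firstE N U).
have : \sum_(V : {set 'I_N} | V \subset U) odd_lassalle #|V| * scat #|U :\: V| = - scat #|U|.+1.
  rewrite -odd_lassalle_conv.
  rewrite (eq_bigr (fun i : 'I_#|U|.+1 => (odd_lassalle i * scat (#|U| - i)) *+ 'C(#|U|, i))).
    rewrite -(sum_subset_card U (fun i => odd_lassalle i * scat (#|U| - i))).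
    by apply: eq_bigr => V VU; rewrite cardsD (setIidPr VU).
  by move=> i _; rewrite -mulr_natl natz.
rewrite -e1 (bigD1 U) //= [in RHS](bigD1 U) //= setDv cards0 scat0 !mulr1.
rewrite [X in _ = _ + X](eq_bigr (fun V : {set 'I_N} => odd_lassalle #|V| * scat #|U :\: V|)).
  by move/addIr => ->.
move=> V; rewrite andbC -properEneq => /proper_card ltVU; rewrite IH //.
exact: leq_trans ltVU _.
Qed.

Local Close Scope ring_scope.

Theorem mainTheorem3 :
  (~ exists t : btree, [/\ normalized t, lonely t & ~~ odd (nvertices t)]) /\
  (forall k : nat,
     exists s : seq btree,
       [/\ uniq s,
           (forall t : btree,
              t \in s <-> [/\ normalized t, lonely t & nvertices t = (2 * k + 1)%N])
         & Posz (size s) = lassalle (k + 1)]).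
Proof.
split=> [[t [_ /lonelyE/andP[_ /desc_full_odd ->]]] //|k].
pose n := (2 * k + 1)%N.
(* Removing 0 leaves the labels from 1 to [n]. *)
pose U : {set 'I_n.+1} := [set~ ord0].
have cU : #|U| = n by rewrite cardsC1 card_ord.
have memU (i : 'I_n.+1) : (i \in U) = (0 < i)%N by rewrite !inE -val_eqE lt0n.
exists (lonely_trees U); split; first exact: lonely_trees_uniq.
  move=> t; rewrite mem_lonely_trees.
  split=> [/and3P[ft dt lt]|[[p pt] /lonelyE/andP[/and4P[_ dt ut _] ft] nt]].
    have /labels_inP[ut ltN mt] := lt.
    have pt y : (y \in postorder t) = (0 < y <= n)%N.
      apply/idP/andP => [yt|[y0 yn]].
        by split; [rewrite -(memU (Ordinal (ltN y yt))) -mt | rewrite -ltnS ltN].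
      by rewrite -ltnS in yn; rewrite (mt (Ordinal yn)) memU.
    split; first by exists n.
      apply/lonelyE; rewrite /dec_bin_plane_tree desc_full_nonempty // dt ut ft /= andbT.
      by apply/allP => y; rewrite pt => /andP[].
    by rewrite -size_postorder (perm_size lt) size_map -cardE cU.
  (* Distinct labels that fill the range from 1 to [p] are [p] in number. *)
  have ep : p = n.
    rewrite /n -nt -size_postorder -[p](size_iota 1); apply/esym/perm_size.
    apply: uniq_perm => // [|y]; first exact: iota_uniq.
    by rewrite pt mem_iota inE add1n ltnS.
  rewrite ft dt; apply/labels_inP; split=> // [y|i].
    by rewrite pt inE ep => /andP[].
  by have := ltn_ord i; rewrite pt inE memU ep ltnS => ->; rewrite andbT.
rewrite -[LHS]/(num_lonely U) num_lonely_card cU /odd_lassalle /n.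
by rewrite mul2n !addn1 /= odd_double /= ?doubleK ?uphalf_double.
Qed.
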